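(* Let $(\mathcal M,g)$ be a $d$-dimensional Riemannian manifold, $x\in\mathcal M$, let $\mathcal H_x:\mathrm T_x\mathcal M\to\mathrm T_x\mathcal M$ be a $g_x$-self-adjoint positive semidefinite operator, let $B,\Xi\subset\mathrm T_x\mathcal M$ be $\ell$-dimensional subspaces ($\ell\le d$), $\mathcal F:B\to\Xi$ a full-rank linear map, $\mathcal P_{x,B,\Xi}=\mathcal F\,\Pi_B$ the associated sketching operator, and $\mathcal H_{x,B,\Xi}$ the Riemannian Nyström approximation of $\mathcal H_x$. Then: (i) $0\preceq \mathcal H_{x,B,\Xi}\preceq \mathcal H_x$ and $\operatorname{rank}(\mathcal H_{x,B,\Xi})\le \ell$. (ii) The range of $\mathcal H_{x,B,\Xi}$ depends only on $\mathcal H_x$ and $\Xi$ (i.e. it is the same for every choice of $B$ and of full-rank $\mathcal F:B\to\Xi$ with the given $\Xi$). Furthermore, $$\mathrm{range}(\mathcal H_{x,B,\Xi})=\mathrm{range}\big(\mathcal H_x\mathcal P_{x,B,\Xi}\big)\subseteq\mathrm{range}(\mathcal H_x).$$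
   Context: $\langle\cdot,\cdot\rangle_x$ is the inner product on $\mathrm T_x\mathcal M$ given by $g_x$; adjoints ($^*$), self-adjointness, positive semidefiniteness and orthogonality are with respect to it; $\mathcal L_1\succeq\mathcal L_2$ means $\mathcal L_1-\mathcal L_2$ is positive semidefinite; $^\dagger$ is the Moore--Penrose pseudoinverse. $\Pi_V$ denotes the $g_x$-orthogonal projection onto a subspace $V\subset \mathrm T_x\mathcal M$. Sketching operator: for $\ell$-dimensional subspaces $B,\Xi\subset\mathrm T_x\mathcal M$ and a full-rank linear map $\mathcal F:B\to\Xi$, set $\mathcal P_{x,B,\Xi}:\mathrm T_x\mathcal M\to\mathrm T_x\mathcal M$, $v\mapsto\mathcal F\,\Pi_B[v]$; its adjoint is $\mathcal P_{x,B,\Xi}^*=\mathcal F^*\Pi_\Xi$. Riemannian Nyström approximation of a $g_x$-self-adjoint positive semidefinite operator $\mathcal H_x$: $$\mathcal H_{x,B,\Xi}=\mathcal H_x\mathcal P_{x,B,\Xi}\left(\mathcal P_{x,B,\Xi}^*\mathcal H_x\mathcal P_{x,B,\Xi}\right)^\dagger\mathcal P_{x,B,\Xi}^*\mathcal H_x .$$ *)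

(* Defs.v *)
From HB Require Import structures.
From mathcomp Require Import all_boot all_order all_algebra.
From mathcomp Require Import boolp classical_sets reals.
From mathcomp Require Import ring.

Set Implicit Arguments.
Unset Strict Implicit.
Unset Printing Implicit Defensive.

Import GRing.Theory Num.Theory.

Local Open Scope ring_scope.

(* Everything happens in one fibre: T is the tangent space at the base point and
   g the inner product that the Riemannian metric puts on it.  Any real inner
   product space of finite dimension d is such a fibre (take the flat metric on
   the space itself), so quantifying over (T, g) is quantifying over the
   tangent spaces of d-dimensional Riemannian manifolds. *)

Section InnerProduct.
Variables (R : realType) (T : vectType R) (g : {dot T for idfun}).
Implicit Types (f h K X : 'End(T)) (U : {vspace T}) (u v w : T).

Definition selfadjoint f := forall u v, g (f u) v = g u (f v).

Definition psd f := selfadjoint f /\ forall u, 0 <= g (f u) u.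

Definition loewner_le f h := psd (h - f).

Definition orthproj U : 'End(T) := daddv_pi U (orthov g U).

(* The default value 0 is never taken, see [adjointP]. *)
Definition adjoint f : 'End(T) :=
  xget 0 [set h : 'End(T) | forall u v, g (f u) v = g u (h v)]%classic.

Definition penrose K X :=
  [/\ (K \o X \o K)%VF = K, (X \o K \o X)%VF = X,
      selfadjoint (K \o X)%VF & selfadjoint (X \o K)%VF].

(* The default value 0 is never taken, see [pinvP]. *)
Definition pinv K : 'End(T) := xget 0 [set X : 'End(T) | penrose K X]%classic.

Lemma dotC u v : g u v = g v u.
Proof. by have /= := @hermC _ _ _ _ g u v; rewrite expr0 mul1r. Qed.

Lemma dotBl u v w : g (u - v) w = g u w - g v w.
Proof. exact: linearBl. Qed.

Lemma dotBr u v w : g w (u - v) = g w u - g w v.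
Proof. exact: linearBr. Qed.

Lemma dotDl u v w : g (u + v) w = g u w + g v w.
Proof. exact: linearDl. Qed.

Lemma dotDr u v w : g w (u + v) = g w u + g w v.
Proof. exact: linearDr. Qed.

Lemma dotZl a u v : g (a *: u) v = a * g u v.
Proof. exact: linearZl_LR. Qed.

Lemma dotZr a u v : g u (a *: v) = a * g u v.
Proof. exact: linearZr_LR. Qed.

Lemma dot0l u : g 0 u = 0.
Proof. exact: linear0l. Qed.

Lemma dot0r u : g u 0 = 0.
Proof. exact: linear0r. Qed.

Lemma dot_eq0 u : g u u = 0 -> u = 0.
Proof.
move=> guu; apply/eqP; apply: contraT => u0.
by have := @neq0_dnorm_gt0 _ _ _ g u u0; rewrite guu Order.POrderTheory.ltxx.
Qed.

Lemma dot_inj u v : (forall w, g w u = g w v) -> u = v.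
Proof.
move=> E; apply/eqP; rewrite -subr_eq0; apply/eqP; apply: dot_eq0.
by rewrite dotBr E subrr.
Qed.

Lemma dotoP U u : reflect {in U, forall v, g u v = 0} (u \in orthov g U).
Proof. exact: mem_orthovP. Qed.

Lemma orthovI0 U : (U :&: orthov g U = 0)%VS.
Proof.
apply/eqP; rewrite -subv0; apply/subvP => u /memv_capP[uU /dotoP uo].
by rewrite (dot_eq0 (uo u uU)) mem0v.
Qed.

Lemma orthov_split U u : exists2 v, v \in U & u - v \in orthov g U.
Proof.
pose c w : 'rV[R]_(\dim U) := \row_i g (vbasis U)`_i w.
have c_lin : linear c.
  by move=> a w1 w2; apply/rowP => i; rewrite !mxE dotDr dotZr.
pose cL := GRing.isLinear.Build _ _ _ _ c c_lin.
pose C : {linear T -> 'rV[R]_(\dim U)} := HB.pack c cL.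
have cU w : c w = 0 -> forall v, v \in U -> g v w = 0.
  move=> cw0 v /coord_vbasis ->; rewrite linear_sumlz big1 // => i _.
  rewrite [LHS]dotZl; move/rowP/(_ i): cw0; rewrite !mxE => ->.
  exact: mulr0.
have inj : (U :&: lker (linfun C) = 0)%VS.
  apply/eqP; rewrite -subv0; apply/subvP => w /memv_capP[wU].
  rewrite memv_ker lfunE => /eqP /cU /(_ w wU) /dot_eq0 ->; exact: mem0v.
have /eqP full : (linfun C @: U == fullv)%VS.
  by rewrite eqEdim subvf dimvf /= (limg_dim_eq inj) /dim /= mul1n leqnn.
have : linfun C u \in (linfun C @: U)%VS by rewrite full memvf.
case/memv_imgP => v vU; rewrite !lfunE /= => cuv; exists v => //.
apply/dotoP => w wU; rewrite dotC; apply: cU wU.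
by rewrite -[c]/(C : T -> _) linearB /= cuv subrr.
Qed.

Lemma orthprojP U u : orthproj U u \in U /\ u - orthproj U u \in orthov g U.
Proof.
split; first exact: memv_pi.
have [v vU uv] := orthov_split U u.
suff -> : orthproj U u = v by [].
have dj := orthovI0 U.
have dj' : (orthov g U :&: U = 0)%VS by rewrite capvC.
rewrite -{1}(subrK v u) linearD /= /orthproj (daddv_pi_id dj vU).
have /= := @daddv_pi_add _ _ U (orthov g U) (u - v) dj.
rewrite (daddv_pi_id dj' uv) => /(_ (subvP (addvSr _ _) _ uv)).
by move=> /(canRL (addrK _)); rewrite subrr => ->; rewrite add0r.
Qed.

Lemma orthproj_sa U : selfadjoint (orthproj U).
Proof.
have H u v : g (orthproj U u) v = g (orthproj U u) (orthproj U v).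
  have [pu _] := orthprojP U u; have [_ /dotoP/(_ _ pu) vo] := orthprojP U v.
  by apply/eqP; rewrite -subr_eq0 -dotBr dotC vo.
by move=> u v; rewrite H dotC -H dotC.
Qed.

Lemma adjointP f u v : g (f u) v = g u (adjoint f v).
Proof.
suff [h hP] : exists h : 'End(T), forall u v, g (f u) v = g u (h v).
  pose A := [set h : 'End(T) | forall u v, g (f u) v = g u (h v)]%classic.
  exact: (@xgetPex _ 0 A (ex_intro _ h hP)).
have riesz w : {z | forall u, g (f u) w = g u z}.
  apply: cid.
  pose phi : {linear T -> R^o} := applyr g w.
  pose K := lker (linfun phi \o f)%VF.
  have KE x : (x \in K) = (g (f x) w == 0) by rewrite memv_ker comp_lfunE lfunE.
  have [] := pselect (exists x, g (f x) w != 0); last first.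
    move=> N; exists 0 => x; rewrite dot0r; apply/eqP; apply: contraT => n0.
    by case: N; exists x.
  case=> x x0; have [y yK xyK] := orthov_split K x.
  pose z := x - y.
  have fz : g (f z) w = g (f x) w.
    by rewrite linearB dotBl (eqP (_ : g (f y) w == 0)) ?subr0 // -KE.
  have z0 : g z z != 0.
    by apply: contra_neq x0 => /dot_eq0 z0; rewrite -fz z0 linear0 dot0l.
  exists ((g (f x) w / g z z) *: z) => t.
  pose a := g (f t) w / g (f x) w.
  have : t - a *: z \in K.
    by rewrite KE linearB linearZ dotBl dotZl /= fz /a divfK // subrr.
  move=> tK; have /dotoP/(_ _ tK) := xyK; rewrite -/z dotBr dotC.
  rewrite dotZr /= => /eqP; rewrite subr_eq0 => /eqP tz.
  rewrite dotZr /= tz /a mulrACA; field.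
  by apply/andP.
pose h0 w := projT1 (riesz w).
have h0P a b : g (f a) b = g a (h0 b) by exact: (projT2 (riesz b)).
have h0_lin : linear h0.
  move=> a b c; apply: dot_inj => x.
  by rewrite -h0P !dotDr !dotZr /= -!h0P.
pose h0L := GRing.isLinear.Build _ _ _ _ h0 h0_lin.
pose H : {linear T -> T} := HB.pack h0 h0L.
by exists (linfun H) => a b; rewrite lfunE h0P.
Qed.

Lemma pinvP K : penrose K (pinv K).
Proof.
pose Q := orthproj (orthov g (lker K)); pose P := orthproj (limg K).
apply: (@xgetPex _ 0 [set X : 'End(T) | penrose K X]%classic).
exists (Q \o K^-1 \o P)%VF.
have oo U u : (forall v, v \in orthov g U -> g u v = 0) -> u \in U.
  move=> H; have [w wU uw] := orthov_split U u.
  suff -> : u = w by [].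
  apply/eqP; rewrite -subr_eq0; apply/eqP; apply: (@dot_eq0 (u - w)).
  have /dotoP/(_ _ wU) uw0 := uw.
  by rewrite dotBl (H _ uw) dotC uw0 subr0.
have KQ u : K (Q u) = K u.
  have [_ /dotoP uQ] := orthprojP (orthov g (lker K)) u.
  have : u - Q u \in lker K by apply: oo.
  by rewrite memv_ker linearB subr_eq0 => /eqP.
have Q0 u : K u = 0 -> Q u = 0.
  move=> Ku; have uK : u \in lker K by rewrite memv_ker Ku.
  have [_] := orthprojP (orthov g (lker K)) u; rewrite -/Q => H.
  have [qo _] := orthprojP (orthov g (lker K)) u.
  have qK : Q u \in lker K by rewrite memv_ker KQ Ku.
  by move/dotoP/(_ _ qK)/dot_eq0: qo.
have KV u : u \in limg K -> K (K^-1%VF u) = u by exact: limg_lfunVK.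
have KQVP : (K \o (Q \o K^-1 \o P))%VF = P.
  apply/lfunP => u; rewrite !comp_lfunE KQ KV //; exact: memv_pi.
have PK u : P (K u) = K u.
  by rewrite /P /orthproj daddv_pi_id ?orthovI0 ?memv_img ?memvf.
have QVPK : (Q \o K^-1 \o P \o K)%VF = Q.
  apply/lfunP => u; rewrite !comp_lfunE PK.
  apply/eqP; rewrite -subr_eq0 -linearB; apply/eqP; apply: Q0.
  by rewrite linearB /= KV ?subrr // memv_img ?memvf.
split.
- by rewrite KQVP; apply/lfunP => u; rewrite comp_lfunE PK.
- rewrite QVPK; apply/lfunP => u; rewrite !comp_lfunE.
  rewrite /Q /orthproj daddv_pi_proj // orthovI0 //.
- by rewrite KQVP; exact: orthproj_sa.
- by rewrite QVPK; exact: orthproj_sa.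
Qed.

Lemma penrose_uniq K X Y : penrose K X -> penrose K Y -> X = Y.
Proof.
move=> [/lfunP KXK /lfunP XKX sKX sXK] [/lfunP KYK /lfunP YKY sKY sYK].
have cE := comp_lfunE.
have kxk u : K (X (K u)) = K u by have := KXK u; rewrite !cE.
have kyk u : K (Y (K u)) = K u by have := KYK u; rewrite !cE.
have kx u v : g (K (X u)) v = g u (K (X v)) by have := sKX u v; rewrite !cE.
have ky u v : g (K (Y u)) v = g u (K (Y v)) by have := sKY u v; rewrite !cE.
have xk u v : g (X (K u)) v = g u (X (K v)) by have := sXK u v; rewrite !cE.
have yk u v : g (Y (K u)) v = g u (Y (K v)) by have := sYK u v; rewrite !cE.
have e1 u : K (X u) = K (Y u).
  by apply: dot_inj => w; rewrite -(kyk (X u)) -ky -kx kxk ky.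
have e2 u : X (K u) = Y (K u).
  by apply: dot_inj => w; rewrite -{1}(kyk u) -xk -yk kxk yk.
apply/lfunP => u; have := XKX u; have := YKY u; rewrite !cE => <- <-.
by rewrite e2 e1.
Qed.

End InnerProduct.

Section Nystrom.
Variables (R : realType) (T : vectType R) (g : {dot T for idfun}).

Definition full_rank (aT rT : vectType R) (F : 'Hom(aT, rT)) :=
  \dim (limg F) = minn (\dim {:aT}) (\dim {:rT}).

(* [vsproj B] and [vsval] only convert between T and the subspaces seen as types:
   [vsproj B] is applied to vectors of B. *)
Definition sketch (B Xi : {vspace T}) (F : 'Hom(subvs_of B, subvs_of Xi)) :
    'End(T) :=
  (linfun vsval \o F \o linfun (vsproj B) \o orthproj g B)%VF.

Definition nystrom (H : 'End(T)) (B Xi : {vspace T})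
    (F : 'Hom(subvs_of B, subvs_of Xi)) : 'End(T) :=
  let P := sketch F in let Pa := adjoint g P in
  (H \o P \o pinv g (Pa \o H \o P) \o Pa \o H)%VF.

Lemma sketchE (B Xi : {vspace T}) (F : 'Hom(subvs_of B, subvs_of Xi)) v :
  sketch F v = vsval (F (vsproj B (orthproj g B v))).
Proof. by rewrite !comp_lfunE !lfunE. Qed.

End Nystrom.

(* Main.v *)
(* Write P for the sketching operator, S = P^* H P, and X for the pseudoinverse
   of S, so that the Nystrom approximation is N = H P X P^* H.  Uniqueness of
   the pseudoinverse makes X self-adjoint, and X = X S X makes it positive
   semidefinite; hence so is N.  With w = P X P^* H u one has
   <H u, w> = <H w, w> = <N u, u>, so that <(H - N) u, u> = <H (u - w), u - w>
   is nonnegative.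
   For the range, z = v - X S v satisfies S z = 0, hence <H P z, P z> = 0, and
   H P z = 0 because H is positive semidefinite; this says H P v = N (P v), so
   N and H P have the same range, namely the image of Xi under H. *)

Require Import Defs.
From mathcomp Require Import all_boot all_order all_algebra.
From mathcomp Require Import reals.
From mathcomp Require Import lra.

Set Implicit Arguments.
Unset Strict Implicit.

Local Open Scope ring_scope.

Import GRing.Theory Num.Theory.

Section PositiveSemidefinite.
Variables (R : realType) (T : vectType R) (g : {dot T for (@idfun R)}).
Implicit Types (f h H K P X : 'End(T)) (u v w z : T).

Lemma adjointPl f u v : g (adjoint g f u) v = g u (f v).
Proof. by rewrite dotC -adjointP dotC. Qed.

(** The quadratic form of [H] is minimal at [z], so its gradient there, twice [H z], must vanish; it
    is tested along the direction [H z]. *)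
Lemma psd_eq0 H z : psd g H -> g (H z) z = 0 -> H z = 0.
Proof.
move=> [H_sa H_ge0] Hz0; apply: (@dot_eq0 _ _ g).
set a := g (H z) (H z); pose b := g (H (H z)) (H z).
have b_ge0 : 0 <= b by exact: H_ge0.
(* The quadratic form of H at this vector is [- a ^+ 2 * (b + 2)]. *)
have := H_ge0 ((b + 1) *: z - a *: H z).
rewrite [H (_ - _)]linearB /= ![H (_ *: _)]linearZ /= !(dotBl, dotBr, dotZl, dotZr) Hz0.
rewrite (H_sa (H z) z) -/a -/b => q_ge0.
have a2_le0 : a * a * (b + 2) <= 0 by lra.
have a2_ge0 : 0 <= a * a by rewrite -expr2 sqr_ge0.
have a2_0 : a * a = 0 by nra.
by move/eqP: a2_0; rewrite mulf_eq0 orbb => /eqP.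
Qed.

Lemma psd_congr K P : psd g K -> psd g (adjoint g P \o K \o P)%VF.
Proof.
move=> [K_sa K_ge0]; split=> [u v | u]; rewrite !comp_lfunE adjointPl //.
by rewrite K_sa -adjointP.
Qed.

(** As [K] is its own adjoint, taking adjoints preserves each of the first two Penrose equations and
    exchanges the two symmetry conditions. *)
Lemma penrose_adjoint K X :
  selfadjoint g K -> penrose g K X -> penrose g K (adjoint g X).
Proof.
move=> K_sa [/lfunP KXK /lfunP XKX KX_sa XK_sa].
have kx u v : g (K (X u)) v = g u (K (X v)) by have := KX_sa u v; rewrite !comp_lfunE.
have xk u v : g (X (K u)) v = g u (X (K v)) by have := XK_sa u v; rewrite !comp_lfunE.
split.
- apply/lfunP => v; apply: (@dot_inj _ _ g) => w; rewrite !comp_lfunE.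
  rewrite -K_sa -adjointP -K_sa -[in RHS]K_sa.
  by have := KXK w; rewrite !comp_lfunE => ->.
- apply/lfunP => v; apply: (@dot_inj _ _ g) => w; rewrite !comp_lfunE.
  rewrite -!adjointP -K_sa -adjointP.
  by have := XKX w; rewrite !comp_lfunE => ->.
- by move=> u v; rewrite !comp_lfunE K_sa adjointPl -xk -[in RHS]K_sa -adjointP.
- by move=> u v; rewrite !comp_lfunE adjointPl K_sa -kx -adjointP K_sa.
Qed.

Lemma selfadjoint_pinv K : selfadjoint g K -> selfadjoint g (pinv g K).
Proof.
move=> K_sa u v; rewrite adjointP.
by rewrite (penrose_uniq (penrose_adjoint K_sa (pinvP g K)) (pinvP g K)).
Qed.

Lemma pinvK K v : K (pinv g K (K v)) = K v.
Proof. by have [/lfunP/(_ v) + _ _ _] := pinvP g K; rewrite !comp_lfunE. Qed.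

Lemma pinvVK K v : pinv g K (K (pinv g K v)) = pinv g K v.
Proof. by have [_ /lfunP/(_ v) + _ _] := pinvP g K; rewrite !comp_lfunE. Qed.

Lemma psd_pinv K : psd g K -> psd g (pinv g K).
Proof.
move=> [K_sa K_ge0]; have X_sa := selfadjoint_pinv K_sa.
by split=> // u; rewrite -pinvVK X_sa.
Qed.

End PositiveSemidefinite.

Section Nystrom.
Variables (R : realType) (T : vectType R) (g : {dot T for (@idfun R)}).
Variables (H : 'End(T)) (B Xi : {vspace T}).
Variable F : 'Hom(subvs_of B, subvs_of Xi).
Hypothesis H_psd : psd g H.

Let P := sketch g F.
Let S := (adjoint g P \o H \o P)%VF.
Let N := nystrom g H F.

Let SE v : S v = adjoint g P (H (P v)).
Proof. by rewrite !comp_lfunE. Qed.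

Let NE v : N v = H (P (pinv g S (adjoint g P (H v)))).
Proof. by rewrite !comp_lfunE. Qed.

Let S_psd : psd g S. Proof. exact: psd_congr. Qed.

(** The form of [N] is that of the pseudoinverse of [S] pulled back along P^* H, so symmetry and
    positivity carry over. *)
Lemma nystrom_form u v :
  g (N u) v = g (pinv g S (adjoint g P (H u))) (adjoint g P (H v)).
Proof. by rewrite NE H_psd.1 adjointP. Qed.

Lemma psd_nystrom : psd g N.
Proof.
have [X_sa X_ge0] := psd_pinv S_psd.
split=> [u v | u]; rewrite nystrom_form //.
by rewrite X_sa [RHS]dotC nystrom_form dotC.
Qed.

Lemma nystrom_le : loewner_le g N H.
Proof.
have [N_sa _] := psd_nystrom; have [H_sa H_ge0] := H_psd.
split=> [u v | u]; rewrite !(add_lfunE, opp_lfunE).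
  by rewrite dotBl dotBr H_sa N_sa.
pose c := adjoint g P (H u); pose w := P (pinv g S c).
have Hw : H w = N u by rewrite NE.
have Nuw : g (N u) w = g (N u) u.
  rewrite !nystrom_form -/c -SE.
  by rewrite (selfadjoint_pinv S_psd.1) pinvVK dotC.
have Huw : g (H u) w = g (N u) u by rewrite H_sa Hw dotC.
(* The terms paired with [w] cancel, which leaves the form of H - N at [u]. *)
have := H_ge0 (u - w); rewrite [H (_ - _)]linearB /= Hw.
by rewrite !(dotBl, dotBr) Huw Nuw subrr subr0.
Qed.

Lemma limg_nystrom : limg N = limg (H \o P)%VF.
Proof.
apply/eqP; rewrite eqEsubv; apply/andP; split; apply/subvP => _ /memv_imgP[v _ ->].
  by rewrite NE -[H (P _)]comp_lfunE memv_img ?memvf.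
suff -> : (H \o P)%VF v = N (P v) by rewrite memv_img ?memvf.
rewrite comp_lfunE NE -SE; apply/eqP.
rewrite -subr_eq0 -!linearB; apply/eqP/(psd_eq0 H_psd).
by rewrite -adjointPl -SE [S (_ - _)]linearB /= pinvK subrr dot0l.
Qed.

End Nystrom.

(** Equal dimensions make a full-rank [F] onto, and the projection onto [B] fixes [B], so a preimage
    under [F] is also one under the sketch. *)
Lemma limg_sketch (R : realType) (T : vectType R) (g : {dot T for (@idfun R)})
    (B Xi : {vspace T}) (F : 'Hom(subvs_of B, subvs_of Xi)) :
  \dim B = \dim Xi -> full_rank F -> limg (sketch g F) = Xi.
Proof.
move=> dim_BXi F_full; apply/eqP; rewrite eqEsubv; apply/andP; split.
  by apply/subvP => _ /memv_imgP[v _ ->]; rewrite sketchE subvsP.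
have F_onto : limg F = fullv.
  apply/eqP; rewrite eqEdim subvf F_full !dimvf /=.
  by rewrite /dim /= dim_BXi minnn.
apply/subvP => y y_Xi; have : vsproj Xi y \in limg F by rewrite F_onto memvf.
case/memv_imgP => b _ yE; have -> : y = sketch g F (vsval b).
  rewrite sketchE [orthproj g B _]daddv_pi_id ?orthovI0 ?subvsP //.
  by rewrite vsvalK -yE vsprojK.
by rewrite memv_img ?memvf.
Qed.

Theorem proposition2p2 (R : realType) (d l : nat)
    (TxM : vectType R) (g : {dot TxM for (@idfun R)})
    (H : 'End(TxM)) (B Xi : {vspace TxM})
    (F : 'Hom(subvs_of B, subvs_of Xi))
    (dim_TxM : \dim {:TxM} = d) (le_ld : (l <= d)%N)
    (H_sa : selfadjoint g H) (H_psd : psd g H)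
    (dim_B : \dim B = l) (dim_Xi : \dim Xi = l) (F_full : full_rank F) :
  [/\ loewner_le g 0 (nystrom g H F), loewner_le g (nystrom g H F) H
    & (\dim (limg (nystrom g H F)) <= l)%N]
  /\
  [/\ forall (B' : {vspace TxM}) (F' : 'Hom(subvs_of B', subvs_of Xi)),
        \dim B' = l -> full_rank F' ->
        limg (nystrom g H F') = limg (nystrom g H F),
      limg (nystrom g H F) = limg (H \o sketch g F)%VF
    & (limg (H \o sketch g F)%VF <= limg H)%VS].
Proof.
(* The image of [Xi] under [H] involves neither [B'] nor [F']; this gives the independence in (ii)
   and, by rank-nullity, the rank bound in (i). *)
have rangeE (B' : {vspace TxM}) (F' : 'Hom(subvs_of B', subvs_of Xi)) :
    \dim B' = l -> full_rank F' -> limg (nystrom g H F') = (H @: Xi)%VS.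
  move=> dim_B' F'_full; rewrite limg_nystrom // limg_comp limg_sketch //.
  by rewrite dim_B' dim_Xi.
split; split.
- by rewrite /loewner_le subr0; exact: psd_nystrom.
- exact: nystrom_le.
- by rewrite rangeE // -dim_Xi -(limg_ker_dim H Xi) leq_addl.
- by move=> B' F' dim_B' F'_full; rewrite !rangeE.
- exact: limg_nystrom.
- by rewrite limg_comp limgS ?subvf.
Qed.
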